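(* Let $m\geq 1$ and $p_0\geq 4$ be integers. Then the Bahri–Xu inequality $\mathrm{BX}(p,m)$ holds for every $4\leq p\leq p_0$ if and only if for every $4\leq p\leq p_0$ and all distinct $x_1,\dots,x_p\in\mathbb R^m$, the system of equations $$\sum_{j\neq i}\frac{u_j}{|x_i-x_j|}=0,\quad 1\leq i\leq p,$$ $$u_i\sum_{j\neq i}\frac{x_i-x_j}{|x_i-x_j|^3}\,u_j=0,\quad 1\leq i\leq p,$$ in the unknowns $(u_1,\dots,u_p)\in\mathbb R^p$ has no non-zero solution.
   Context: $|\cdot|$ is the Euclidean norm. For integers $p\geq 2$, $m\geq 1$, the Bahri–Xu inequality $\mathrm{BX}(p,m)$ (the Bahri–Xu conjecture for $p$ points in $\mathbb R^m$) is the assertion: there is a constant $c(p,m)>0$, depending only on $p$ and $m$, such that for all distinct $x_1,\dots,x_p\in\mathbb R^m$ and all $U=(u_1,\dots,u_p)^{\mathrm T}\in\mathbb R^p$, $$\sum_{1\leq i\leq p}\Big|\sum_{j\neq i}\frac{u_j}{|x_i-x_j|}\Big|^2+2\sup_{1\leq i\leq p}\Big|\sum_{j\neq i}u_i\frac{x_i-x_j}{|x_i-x_j|^3}u_j\Big|\;\geq\; c(p,m)\sum_{\substack{1\leq i,j\leq p\\ j\neq i}}\frac{u_j^2}{|x_i-x_j|^2}.$$ Equivalently, $|AU|^2+\sup_i|U^{\mathrm T}(\partial A/\partial x_i)U|\geq c(p,m)\sum_{i\neq j}u_j^2/|x_i-x_j|^2$, where $A$ is the symmetric $p\times p$ matrix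 with zero diagonal and off-diagonal entries $1/|x_i-x_j|$. *)

(* Defs.v *)
From mathcomp Require Import all_boot all_order all_algebra.
From mathcomp Require Import reals.

Set Implicit Arguments.
Unset Strict Implicit.
Unset Printing Implicit Defensive.

Import Order.TTheory GRing.Theory Num.Theory.

Local Open Scope ring_scope.

(* The norm that MathComp-Analysis puts on row vectors is the maximum norm,
   hence this separate definition. *)
Definition enorm (R : realType) (m : nat) (v : 'rV[R]_m) : R :=
  Num.sqrt (\sum_(k < m) v 0 k ^+ 2).

(* The i-th entry of A U, where A is the symmetric p x p matrix with zero
   diagonal and off-diagonal entries 1 / |x_i - x_j|. *)
Definition potential (R : realType) (m p : nat) (x : 'I_p -> 'rV[R]_m)
    (U : 'cV[R]_p) (i : 'I_p) : R :=
  \sum_(j < p | j != i) U j 0 / enorm (x i - x j).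

Definition force_field (R : realType) (m p : nat) (x : 'I_p -> 'rV[R]_m)
    (U : 'cV[R]_p) (i : 'I_p) : 'rV[R]_m :=
  \sum_(j < p | j != i) (U j 0 / enorm (x i - x j) ^+ 3) *: (x i - x j).

(* The supremum over the finitely many i is a maximum; its default value 0 is
   harmless because the terms are nonnegative. *)
Definition bahri_xu (R : realType) (p m : nat) : Prop :=
  exists2 c : R, 0 < c &
    forall (x : 'I_p -> 'rV[R]_m) (U : 'cV[R]_p), injective x ->
      c * (\sum_(i < p) \sum_(j < p | j != i) U j 0 ^+ 2 / enorm (x i - x j) ^+ 2)
      <= \sum_(i < p) `|potential x U i| ^+ 2
         + 2 * \big[Num.max/0]_(i < p) enorm
               (\sum_(j < p | j != i)
                  (U i 0 * U j 0 / enorm (x i - x j) ^+ 3) *: (x i - x j)).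

Definition bahri_xu_system (R : realType) (p m : nat) (x : 'I_p -> 'rV[R]_m)
    (U : 'cV[R]_p) : Prop :=
  (forall i : 'I_p, potential x U i = 0)
  /\ (forall i : 'I_p, U i 0 *: force_field x U i = 0).

(* Main.v *)
Require Import Defs.
From mathcomp Require Import all_boot all_order all_algebra.
From mathcomp Require Import reals.
From mathcomp Require Import ring zify.
From mathcomp Require Import boolp classical_sets filter topology normedtype.
From mathcomp Require Import realfun sequences function_spaces.

(* If the inequality fails for p points, there are normalized configurations
   along which potentials and forces tend to 0; take limits along an
   ultrafilter, after rescaling to unit size. The points group into clusters
   around their limits, and only isolated points keep a charge in the limit,
   so a cluster sees the rest of the configuration as a constant potential
   phi. By induction on the number of points, phi vanishes around each
   proper cluster and its charges are negligible, while the isolated points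
   solve the limit system with potential -phi. A solution with phi <> 0 is
   ruled out by the Kelvin transform: inversion turns phi into a charge at
   one additional point, which gives a solution of the original system. For
   phi = 0 the hypothesis applies, and for two or three points the potential
   equations alone are nondegenerate. *)

Set Implicit Arguments.
Unset Strict Implicit.
Unset Printing Implicit Defensive.

Import Order.TTheory GRing.Theory Num.Theory.
Import numFieldNormedType.Exports.

Local Open Scope ring_scope.

(** * Scalar product and Euclidean norm *)

Section EuclideanNorm.
Context {R : realType} {m : nat}.
Implicit Types v w : 'rV[R]_m.

Definition dotp v w : R := \sum_(k < m) v 0 k * w 0 k.

Lemma dotpC v w : dotp v w = dotp w v.
Proof. by apply: eq_bigr => k _; rewrite mulrC. Qed.

Lemma dotpDr v w1 w2 : dotp v (w1 + w2) = dotp v w1 + dotp v w2.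
Proof. by rewrite -big_split; apply: eq_bigr => k _; rewrite mxE mulrDr. Qed.

Lemma dotpZr a v w : dotp v (a *: w) = a * dotp v w.
Proof. by rewrite mulr_sumr; apply: eq_bigr => k _; rewrite mxE mulrCA. Qed.

Lemma dotpBr v w1 w2 : dotp v (w1 - w2) = dotp v w1 - dotp v w2.
Proof. by rewrite dotpDr -scaleN1r dotpZr mulN1r. Qed.

Lemma dotp0r v : dotp v 0 = 0.
Proof. by rewrite -(scale0r v) dotpZr mul0r. Qed.

Lemma dotp_sumr (J : Type) (r : seq J) (P : pred J) v (f : J -> 'rV[R]_m) :
  dotp v (\sum_(j <- r | P j) f j) = \sum_(j <- r | P j) dotp v (f j).
Proof. exact: (big_morph _ (dotpDr v) (dotp0r v)). Qed.

Lemma enorm_sqr v : enorm v ^+ 2 = dotp v v.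
Proof.
rewrite sqr_sqrtr; first by apply: eq_bigr => k _; rewrite expr2.
by apply: sumr_ge0 => k _; exact: sqr_ge0.
Qed.

Lemma enorm_ge0 v : 0 <= enorm v.
Proof. exact: sqrtr_ge0. Qed.

Lemma enorm_eq0 v : (enorm v == 0) = (v == 0).
Proof.
rewrite -(sqrf_eq0 (enorm v)) enorm_sqr psumr_eq0; last first.
  by move=> k _; rewrite -expr2 sqr_ge0.
apply/allP/eqP => [v0|-> k _]; last by rewrite mxE mul0r eqxx.
apply/rowP => k; rewrite mxE; apply/eqP.
by have := v0 k (mem_index_enum k); rewrite /= mulf_eq0 orbb.
Qed.

Lemma enorm_gt0 v : (0 < enorm v) = (v != 0).
Proof. by rewrite lt_neqAle enorm_ge0 andbT eq_sym enorm_eq0. Qed.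

Lemma enormN v : enorm (- v) = enorm v.
Proof. by congr Num.sqrt; apply: eq_bigr => k _; rewrite mxE sqrrN. Qed.

Lemma enormB v w : enorm (v - w) = enorm (w - v).
Proof. by rewrite -enormN opprB. Qed.

Lemma enormZ a v : enorm (a *: v) = `|a| * enorm v.
Proof.
rewrite /enorm -sqrtr_sqr -sqrtrM ?sqr_ge0 // mulr_sumr.
by congr Num.sqrt; apply: eq_bigr => k _; rewrite mxE exprMn.
Qed.

Lemma enorm_coord v k : `|v 0 k| <= enorm v.
Proof.
rewrite /enorm -sqrtr_sqr ler_wsqrtr // (bigD1 k) //= lerDl sumr_ge0 // => j _.
exact: sqr_ge0.
Qed.

End EuclideanNorm.

(** * Potentials and forces of charges on a finite set of points *)

Section System.
Context {R : realType} {m : nat} {I : finType}.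
Implicit Types (S : {set I}) (x : I -> 'rV[R]_m) (u : I -> R) (i j : I).

Definition pot S x u i : R := \sum_(j in S | j != i) u j / enorm (x i - x j).

Definition frc S x u i : 'rV[R]_m :=
  \sum_(j in S | j != i) (u j / enorm (x i - x j) ^+ 3) *: (x i - x j).

Lemma sum_pair_swap (V : nmodType) S (G : I -> I -> V) :
  \sum_(i in S) \sum_(j in S | j != i) G i j =
  \sum_(i in S) \sum_(j in S | j != i) G j i.
Proof.
rewrite (exchange_big_dep (mem S)) /=; last by move=> i j _ /andP[].
apply: eq_bigr => i iS; apply: eq_bigl => j.
by rewrite iS eq_sym.
Qed.

(** Newton's third law: exchanging the two points of a pair negates its term, so the sum equals its
    own opposite. *)
Lemma sum_frc S x u : \sum_(i in S) u i *: frc S x u i = 0.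
Proof.
under eq_bigr do rewrite scaler_sumr.
set s := (X in X = 0); suff : s = - s.
  move=> /eqP; rewrite -subr_eq0 opprK -mulr2n -scaler_nat scaler_eq0.
  by rewrite pnatr_eq0 => /eqP.
rewrite {1}/s sum_pair_swap /s -sumrN; apply: eq_bigr => i _.
rewrite -sumrN; apply: eq_bigr => j _.
rewrite !scalerA -scalerN opprB enormB; congr (_ *: _); ring.
Qed.

(* The energy is homogeneous of degree -1 in the points: Euler's identity. *)
Lemma sum_dotp_frc S x u : {in S &, injective x} ->
  2 * (\sum_(i in S) u i * dotp (x i) (frc S x u i)) =
  \sum_(i in S) u i * pot S x u i.
Proof.
move=> xI.
under eq_bigr => i _ do rewrite dotp_sumr mulr_sumr.
(* One of the two copies has its indices swapped, so that each pair contributes [x i - x j] paired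
   with itself, a squared distance. *)
rewrite -[2]/(1 + 1) mulrDl mul1r {1}sum_pair_swap -big_split /=.
apply: eq_bigr => i iS; rewrite -big_split /= mulr_sumr.
apply: eq_bigr => j /andP[jS ji].
have d0 : enorm (x i - x j) != 0.
  by rewrite enorm_eq0 subr_eq0; apply: contra ji => /eqP/xI ->.
rewrite !dotpZr (enormB (x j)) !dotpBr (dotpC (x j) (x i)).
have := enorm_sqr (x i - x j).
rewrite dotpBr ![dotp (_ - _) _]dotpC !dotpBr (dotpC (x j) (x i)).
set d := enorm _ in d0 * => ed.
have -> : u i * (u j / d) = u i * u j * d ^+ 2 / d ^+ 3 by field.
rewrite ed; field.
by rewrite d0.
Qed.

End System.

(** * Nondegeneracy of the system *)

Section Rigidity.
Context (R : realType) (m : nat).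

Definition rigid (q : nat) : Prop :=
  forall (x : 'I_q -> 'rV[R]_m) (U : 'cV[R]_q),
    injective x -> bahri_xu_system x U -> U = 0.

Lemma inv_enorm_neq0 (I : finType) (x : I -> 'rV[R]_m) i j :
  injective x -> i != j -> (enorm (x i - x j))^-1 != 0.
Proof. by move=> xI ij; rewrite invr_neq0 // enorm_eq0 subr_eq0 inj_eq. Qed.

Lemma rigid2 : rigid 2.
Proof.
move=> x U xI [potU _].
have {}potU i : \sum_j (if j != i then U j 0 / enorm (x i - x j) else 0) = 0.
  by rewrite -big_mkcond; exact: potU.
have := potU ord0; have := potU (lift ord0 ord0).
rewrite !big_ord_recl !big_ord0 /= !(addr0, add0r).
move=> /eqP; rewrite mulf_eq0 (negPf (inv_enorm_neq0 _ _)) // orbF => /eqP U0.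
move=> /eqP; rewrite mulf_eq0 (negPf (inv_enorm_neq0 _ _)) // orbF => /eqP U1.
apply/colP => -[[|[|//]] lti]; rewrite mxE.
- by rewrite -[RHS]U0; congr (U _ _); exact: val_inj.
- by rewrite -[RHS]U1; congr (U _ _); exact: val_inj.
Qed.

Lemma rigid3 : rigid 3.
Proof.
move=> x U xI [potU _].
have {}potU i : \sum_j (if j != i then U j 0 / enorm (x i - x j) else 0) = 0.
  by rewrite -big_mkcond; exact: potU.
pose i1 : 'I_3 := lift ord0 ord0; pose i2 : 'I_3 := lift ord0 (lift ord0 ord0).
have := potU i2; have := potU i1; have := potU ord0.
rewrite !big_ord_recl !big_ord0 /= !(addr0, add0r).
rewrite -/i1 -/i2 (enormB (x i1) (x ord0)) !(enormB (x i2)).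
have := inv_enorm_neq0 xI (isT : ord0 != i1).
have := inv_enorm_neq0 xI (isT : ord0 != i2).
have := inv_enorm_neq0 xI (isT : i1 != i2).
set a := (enorm _)^-1; set b := (enorm _)^-1; set c := (enorm _)^-1.
move=> a0 b0 c0 e0 e1 e2.
(* The equation at [i1] times [b], plus that at [i2] times [c], minus that at [ord0] times [a],
   eliminates the other two unknowns and leaves twice [b * c * U ord0 0]. *)
have U0 : U ord0 0 = 0.
  apply: (mulfI (mulf_neq0 b0 c0)).
  rewrite [LHS](_ : _ = 2^-1 * (b * (U ord0 0 * c + U i2 0 * a)
    + c * (U ord0 0 * b + U i1 0 * a) - a * (U i1 0 * c + U i2 0 * b))).
    by rewrite e0 e1 e2; ring.
  by field.
have U1 : U i1 0 = 0 by apply: (mulIf a0); rewrite mul0r -[RHS]e2 U0; ring.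
have U2 : U i2 0 = 0 by apply: (mulIf a0); rewrite mul0r -[RHS]e1 U0; ring.
apply/colP => -[[|[|[|//]]] lti]; rewrite mxE.
- by rewrite -[RHS]U0; congr (U _ _); exact: val_inj.
- by rewrite -[RHS]U1; congr (U _ _); exact: val_inj.
- by rewrite -[RHS]U2; congr (U _ _); exact: val_inj.
Qed.

(** Enumerating [S] carries nondegeneracy over to subsets of any finite type: the isolated limit
    points, or a configuration enlarged by a center of inversion. *)
Lemma rigid_set (I : finType) (S : {set I}) (x : I -> 'rV[R]_m) (u : I -> R) :
  rigid #|S| -> {in S &, injective x} ->
  {in S, forall i, pot S x u i = 0} ->
  {in S, forall i, u i *: frc S x u i = 0} ->
  {in S, forall i, u i = 0}.
Proof.
move=> rS xI potS frcS i iS.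
pose U : 'cV[R]_#|S| := \col_k u (enum_val k).
have enE (k k' : 'I_#|S|) : (enum_val k != enum_val k') = (k != k').
  by rewrite (inj_eq enum_val_inj).
have xI' : injective (x \o @enum_val _ (mem S)).
  by move=> k k' /= exx; apply/enum_val_inj/xI => //; exact: enum_valP.
suff sysU : bahri_xu_system (x \o @enum_val _ (mem S)) U.
  have /colP/(_ (enum_rank_in iS i)) := rS _ _ xI' sysU.
  by rewrite !mxE enum_rankK_in.
split=> k.
- rewrite -[RHS](potS (enum_val k)) ?enum_valP // /pot big_enum_val_cond.
  by apply: eq_big => [k'|k' _]; rewrite ?mxE ?enE.
- rewrite -[RHS](frcS (enum_val k)) ?enum_valP // /frc big_enum_val_cond mxE.
  congr (_ *: _).
  by apply: eq_big => [k'|k' _]; rewrite ?mxE ?enE.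
Qed.

(** * Inversion and the Kelvin transform *)

Definition inversion (v : 'rV[R]_m) : 'rV[R]_m := (enorm v ^+ 2)^-1 *: v.

Lemma enorm_inversion v : v != 0 -> enorm (inversion v) = (enorm v)^-1.
Proof.
rewrite -enorm_gt0 => v0; rewrite enormZ ger0_norm ?invr_ge0 ?sqr_ge0 //.
by field; rewrite gt_eqF.
Qed.

Lemma enorm_inversionB v w : v != 0 -> w != 0 ->
  enorm (inversion v - inversion w) = enorm (v - w) / (enorm v * enorm w).
Proof.
rewrite -!enorm_gt0 => v0 w0.
apply: (@pexpIrn _ 2); rewrite ?nnegrE ?divr_ge0 ?mulr_ge0 ?enorm_ge0 //.
rewrite exprMn exprVn exprMn enorm_sqr [X in _ = X / _]enorm_sqr.
have := enorm_sqr v; have := enorm_sqr w.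
rewrite !dotpBr ![dotp (_ - _) _]dotpC !dotpBr !dotpZr.
rewrite ![dotp (inversion _) _]dotpC !dotpZr !(dotpC w v) => <- <-.
by field; rewrite !gt_eqF.
Qed.

Lemma inversion_force_term (a : R) v w : v != 0 -> w != 0 -> v != w ->
  let F := (a / enorm (v - w) ^+ 3) *: (v - w) in
  (a / enorm w / enorm (inversion v - inversion w) ^+ 3)
    *: (inversion v - inversion w) =
  enorm v ^+ 3 *: F + (enorm v * (a / enorm (v - w) - 2 * dotp v F)) *: v.
Proof.
move=> v0 w0 vw F; rewrite enorm_inversionB //.
have := enorm_sqr (v - w).
rewrite /F dotpZr !dotpBr ![dotp (_ - _) _]dotpC !dotpBr !(dotpC w v).
rewrite -!enorm_sqr /inversion.
move: v0 w0 vw; rewrite -[v == w]subr_eq0 -!enorm_eq0.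
set n := enorm v; set q := enorm w; set d := enorm (v - w); set s := dotp v w.
move=> n0 q0 d0 ed.
(* The law of cosines removes the scalar product, after which the identity is rational in the three
   lengths. *)
have -> : s = (n ^+ 2 + q ^+ 2 - d ^+ 2) / 2 by rewrite ed; field.
apply/rowP => k; rewrite !mxE.
by field; rewrite n0 q0 d0.
Qed.

Lemma big_option (V : nmodType) (J : finType) (P : pred (option J))
    (f : option J -> V) :
  \sum_(o | P o) f o =
  (if P None then f None else 0) + \sum_(j | P (Some j)) f (Some j).
Proof.
rewrite (bigID (pred1 None)) /=; congr (_ + _).
  by rewrite big_mkcondl big_pred1_eq.
rewrite (reindex_omap Some id) => [|[j|]] //=; last by rewrite andbF.
by apply: eq_bigl => j; rewrite eqxx !andbT.
Qed.

(** A vector whose entries exceed the norms of all the points differs from each of them in the first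
    coordinate, which exists as [m] is positive. *)
Lemma center_off (I : finType) (S : {set I}) (x : I -> 'rV[R]_m) :
  (0 < m)%N -> exists o, forall i, i \in S -> x i - o != 0.
Proof.
move=> m_gt0; exists (const_mx (1 + \sum_(i in S) enorm (x i))) => i iS.
apply/eqP => /rowP/(_ (Ordinal m_gt0)); rewrite !mxE; apply/eqP.
rewrite subr_eq0 lt_eqF //.
apply: le_lt_trans (ler_norm _) _; apply: le_lt_trans (enorm_coord _ _) _.
rewrite (bigD1 i) //= addrCA ltrDl ltr_wpDr // sumr_ge0 // => j _.
exact: enorm_ge0.
Qed.

Section Kelvin.
Variables (I : finType) (S : {set I}) (w : I -> 'rV[R]_m) (u : I -> R).
Variable phi : R.
Hypothesis w_neq0 : forall i, i \in S -> w i != 0.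
Hypothesis w_inj : {in S &, injective w}.

(** [None] is the image of infinity: a constant potential, as if created at infinity, becomes a
    charge at the origin. *)
Definition kelvin_set : {set option I} := None |: Some @: S.
Definition kelvin_point (o : option I) : 'rV[R]_m :=
  if o is Some i then inversion (w i) else 0.
Definition kelvin_charge (o : option I) : R :=
  if o is Some i then u i / enorm (w i) else phi.

Local Notation S' := kelvin_set.
Local Notation y := kelvin_point.
Local Notation c := kelvin_charge.

Lemma in_kelvin_set o : (o \in S') = (if o is Some i then i \in S else true).
Proof.
by case: o => [i|]; rewrite !inE //= mem_imset //; exact: Some_inj.
Qed.

Lemma card_kelvin_set : #|S'| = #|S|.+1.
Proof.
rewrite cardsU1 card_imset; last exact: Some_inj.
by case: imsetP => // -[].
Qed.

Lemma kelvin_point_inj : {in S' &, injective y}.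
Proof.
have inv0 i : i \in S -> inversion (w i) != 0.
  by move=> iS; rewrite -enorm_gt0 enorm_inversion ?invr_gt0 ?enorm_gt0 w_neq0.
move=> [i|] [j|] //; rewrite !in_kelvin_set /=.
- move=> iS jS /eqP; rewrite -subr_eq0 -enorm_eq0 enorm_inversionB ?w_neq0 //.
  rewrite mulf_eq0 invr_eq0 mulf_eq0 !enorm_eq0 !(negPf (w_neq0 _)) // !orbF.
  by rewrite subr_eq0 => /eqP/w_inj ->.
- by move=> /inv0 + _ => /eqP.
- by move=> _ /inv0 + /esym => /eqP.
Qed.

Lemma kelvin_pot i : i \in S ->
  pot S' y c (Some i) = enorm (w i) * (phi + pot S w u i).
Proof.
move=> iS; rewrite /pot big_option !inE /= subr0 enorm_inversion ?w_neq0 //.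
rewrite invrK mulrDr mulrC; congr (_ + _); rewrite mulr_sumr.
apply: eq_big => [j|j /andP[]]; rewrite in_kelvin_set // => jS ji.
rewrite enorm_inversionB ?w_neq0 //=.
have := w_neq0 iS; have := w_neq0 jS; rewrite -!enorm_eq0 => wj0 wi0.
have d0 : enorm (w i - w j) != 0.
  by rewrite enorm_eq0 subr_eq0; apply: contra ji => /eqP/w_inj ->.
by field; rewrite d0 wj0.
Qed.

Lemma kelvin_pot_center : pot S' y c None = \sum_(i in S) u i.
Proof.
rewrite /pot big_option andbF add0r.
apply: eq_big => [j|j /andP[]]; rewrite in_kelvin_set ?andbT // => jS _.
rewrite sub0r enormN enorm_inversion ?w_neq0 //= invrK divfK //.
by rewrite enorm_eq0 w_neq0.
Qed.

(** The radial term gathers the force of the center and the radial parts from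
    [inversion_force_term]. It vanishes once the total potential and the force at [w i] do, so
    solutions go to solutions. *)
Lemma kelvin_frc i : i \in S ->
  frc S' y c (Some i) = enorm (w i) ^+ 3 *: frc S w u i +
  (enorm (w i) * (phi + pot S w u i - 2 * dotp (w i) (frc S w u i))) *: w i.
Proof.
move=> iS; rewrite {1}/frc big_option !inE /= subr0 enorm_inversion ?w_neq0 //.
have wi0 : enorm (w i) != 0 by rewrite enorm_eq0 w_neq0.
rewrite -addrA mulrDr scalerDl addrCA; congr (_ + _).
  by rewrite scalerA; congr (_ *: _); field.
rewrite dotp_sumr mulr_sumr -sumrB mulr_sumr scaler_suml scaler_sumr -big_split.
apply: eq_big => [j|j /andP[]]; rewrite in_kelvin_set // => jS ji.
rewrite inversion_force_term ?w_neq0 //.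
by apply: contra ji => /eqP/w_inj ->.
Qed.

End Kelvin.

(* Inversion in a center off the points turns the constant [phi] into a charge
   sitting at the center.  The potential there is the total charge, which
   vanishes by Euler's identity, and the force there vanishes by Newton's third
   law. *)
Lemma rigid_potential (I : finType) (S : {set I}) (x : I -> 'rV[R]_m)
    (u : I -> R) (phi : R) :
  (0 < m)%N -> rigid #|S|.+1 -> {in S &, injective x} ->
  {in S, forall i, phi + pot S x u i = 0} ->
  {in S, forall i, u i *: frc S x u i = 0} ->
  phi = 0.
Proof.
move=> m_gt0 rS xI potS frcS.
have [o oP] := center_off S x m_gt0.
pose w i := x i - o.
have wB i j : w i - w j = x i - x j by rewrite /w opprB addrA subrK.
have wI : {in S &, injective w} by move=> i j iS jS /addIr/xI ->.
have potw i : pot S w u i = pot S x u i.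
  by apply: eq_bigr => j _; rewrite wB.
have frcw i : frc S w u i = frc S x u i.
  by apply: eq_bigr => j _; rewrite wB.
pose S' := kelvin_set S; pose y := kelvin_point w.
pose c := kelvin_charge w u phi.
apply/eqP; apply: contraT => phi0.
have sumu : \sum_(i in S) u i = 0.
  have := sum_dotp_frc u wI.
  rewrite big1 ?mulr0 => [|i iS]; last by rewrite -dotpZr frcw frcS ?dotp0r.
  rewrite (eq_bigr (fun i => u i * - phi)) => [|i iS]; last first.
    by congr (_ * _); apply/eqP; rewrite -addr_eq0 addrC potw potS.
  rewrite -mulr_suml => /esym/eqP; rewrite mulf_eq0 oppr_eq0 (negPf phi0) orbF.
  by move/eqP.
have frcS' i : i \in S -> c (Some i) *: frc S' y c (Some i) = 0.
  move=> iS; rewrite kelvin_frc // /c /= potw frcw potS // sub0r.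
  have /eqP := frcS i iS; rewrite scaler_eq0 => /orP[]/eqP ->.
    by rewrite mul0r scale0r.
  by rewrite dotp0r !(mulr0, oppr0, scaler0, scale0r) addr0 scaler0.
have frcN : c None *: frc S' y c None = 0.
  have := sum_frc S' y c; rewrite (bigD1 None) ?in_kelvin_set //=.
  rewrite [X in _ + X]big1 ?addr0 // => -[i|]; rewrite in_kelvin_set //=.
  by rewrite andbT; exact: frcS'.
suff c0 : {in S', forall o, c o = 0}.
  by move: phi0; rewrite -[phi]/(c None) c0 ?eqxx ?in_kelvin_set.
apply: (rigid_set (x := y)).
- by rewrite card_kelvin_set.
- exact: kelvin_point_inj.
- move=> [i|]; rewrite in_kelvin_set => iS.
    by rewrite kelvin_pot // potw potS // mulr0.
  by rewrite kelvin_pot_center.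
- by move=> [i|]; rewrite in_kelvin_set => iS; [exact: frcS'|exact: frcN].
Qed.

End Rigidity.

(** * Limits along an ultrafilter *)

Section Limits.
Context {R : realType} {m : nat} (F : set_system nat).
Context {FU : UltraFilter F}.
Local Open Scope classical_set_scope.

(** Compactness of the segment gives a cluster point, and an ultrafilter converges to each of its
    cluster points. *)
Lemma ultra_bounded_cvg (f : nat -> R) (K : R) :
  (forall t, `|f t| <= K) -> f t @[t --> F] --> lim (f t @[t --> F]).
Proof.
move=> fK; apply/cvg_ex.
have FF : ProperFilter (f t @[t --> F]) by exact: fmap_proper_filter.
have [|l [_ fl]] := @segment_compact _ (- K) K _ FF.
  by apply: (@filterE _ F) => t /=; rewrite in_itv /= -ler_norml; exact: fK.
exists l => A lA; have [//|FnA] := in_ultra_setVsetC (f @^-1` A) FU.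
by have [z []] := fl (~` A) A FnA lA.
Qed.

Lemma cvg_sumr (I : Type) (r : seq I) (P : pred I) (f : I -> nat -> R)
    (l : I -> R) :
  (forall i, P i -> f i t @[t --> F] --> l i) ->
  \sum_(i <- r | P i) f i t @[t --> F] --> \sum_(i <- r | P i) l i.
Proof. by move=> fl; apply: cvg_big => //; exact: add_continuous. Qed.

Lemma lim_const_eq (f : nat -> R) (a l : R) :
  f t @[t --> F] --> l -> (forall t, f t = a) -> l = a.
Proof.
move=> fl fa; have fa' : f t @[t --> F] --> a.
  by under eq_cvg do rewrite fa; exact: cvg_cst.
exact: (cvg_unique (@norm_hausdorff _ R^o) fl fa').
Qed.

Section Terms.
Variables (I : finType) (B : {set I}).
Variables (x : nat -> I -> 'rV[R]_m) (u : nat -> I -> R).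
Variables (X : I -> 'rV[R]_m) (U : I -> R).

Lemma cvg_enorm (v : nat -> 'rV[R]_m) (V : 'rV[R]_m) :
  (forall k, v t 0 k @[t --> F] --> V 0 k) ->
  enorm (v t) @[t --> F] --> enorm V.
Proof.
move=> vV; apply: (@continuous_cvg _ _ _ F _ _ Num.sqrt).
  exact: sqrt_continuous.
by apply: cvg_sumr => k _; apply: cvgM; exact: vV.
Qed.

Hypothesis xX : forall i k, i \in B -> x t i 0 k @[t --> F] --> X i 0 k.
Hypothesis uU : forall i, i \in B -> u t i @[t --> F] --> U i.

Lemma cvg_coordB i j k : i \in B -> j \in B ->
  (x t i - x t j) 0 k @[t --> F] --> (X i - X j) 0 k.
Proof.
move=> iB jB; rewrite !mxE; under eq_cvg do rewrite !mxE.
by apply: cvgB; exact: xX.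
Qed.

Lemma cvg_dist i j : i \in B -> j \in B ->
  enorm (x t i - x t j) @[t --> F] --> enorm (X i - X j).
Proof. by move=> iB jB; apply: cvg_enorm => k; exact: cvg_coordB. Qed.

Lemma cvg_pot_term i j : i \in B -> j \in B -> X i != X j ->
  u t j / enorm (x t i - x t j) @[t --> F] --> U j / enorm (X i - X j).
Proof.
move=> iB jB; rewrite -subr_eq0 -enorm_eq0 => d0.
by apply: cvgM; [exact: uU|apply: cvgV => //; exact: cvg_dist].
Qed.

Lemma cvg_frc_term i j k :
  i \in B -> j \in B -> X i != X j ->
  ((u t j / enorm (x t i - x t j) ^+ 3) *: (x t i - x t j)) 0 k @[t --> F] -->
  ((U j / enorm (X i - X j) ^+ 3) *: (X i - X j)) 0 k.
Proof.
move=> iB jB; rewrite -subr_eq0 -enorm_eq0 => d0.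
rewrite mxE; under eq_cvg do rewrite mxE.
apply: cvgM; last exact: cvg_coordB.
apply: cvgM; first exact: uU.
apply: cvgV; first by rewrite expf_neq0.
by apply: (@continuous_cvg _ _ _ F _ _ (fun y : R => y ^+ 3));
  [exact: exprn_continuous|exact: cvg_dist].
Qed.

End Terms.
End Limits.

(** * Collapse of balanced configurations *)

Section Collapse.
Context {R : realType} {m : nat} (F : set_system nat).
Context {FU : UltraFilter F}.
Local Open Scope classical_set_scope.

Section Definitions.
Context {I : finType}.
Variables (B : {set I}) (phi : R).
Variables (x : nat -> I -> 'rV[R]_m) (u : nat -> I -> R).

(* A system of shrinking clusters sees the charges outside as a constant
   potential, hence the constant [phi]. *)
Definition balanced (K : R) : Prop :=
  [/\ forall t, {in B &, injective (x t)},
      forall t, {in B &, forall i j, i != j ->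
        `|u t j| <= K * enorm (x t i - x t j)},
      {in B, forall i, phi + pot B (x t) (u t) i @[t --> F] --> (0 : R)}
    & {in B, forall i, forall k,
        (u t i *: frc B (x t) (u t) i) 0 k @[t --> F] --> (0 : R)}].

Definition negligible_charges : Prop :=
  {in B &, forall i j, i != j ->
    u t j / enorm (x t i - x t j) @[t --> F] --> (0 : R)}.

End Definitions.

Lemma pot_split (I : finType) (B : {set I}) (P : pred I) (x : I -> 'rV[R]_m)
    (u : I -> R) i : P i ->
  pot B x u i = pot [set j in B | P j] x u i +
    \sum_(j in B | ~~ P j) u j / enorm (x i - x j).
Proof.
move=> Pi; rewrite /pot (bigID P) /=; congr (_ + _); apply: eq_bigl => j.
  by rewrite !inE andbAC.
by case: eqVneq => [->|]; rewrite ?andbT // Pi !andbF.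
Qed.

Lemma frc_split (I : finType) (B : {set I}) (P : pred I) (x : I -> 'rV[R]_m)
    (u : I -> R) i : P i ->
  frc B x u i = frc [set j in B | P j] x u i +
    \sum_(j in B | ~~ P j) (u j / enorm (x i - x j) ^+ 3) *: (x i - x j).
Proof.
move=> Pi; rewrite /frc (bigID P) /=; congr (_ + _); apply: eq_bigl => j.
  by rewrite !inE andbAC.
by case: eqVneq => [->|]; rewrite ?andbT // Pi !andbF.
Qed.

Lemma similarityB (I : Type) (x : I -> 'rV[R]_m) (s : R) (o : 'rV[R]_m) i j :
  s *: (x i - o) - s *: (x j - o) = s *: (x i - x j).
Proof. by rewrite -scalerBr opprB addrA subrK. Qed.

Lemma similarity_dist (I : Type) (x : I -> 'rV[R]_m) (s : R) (o : 'rV[R]_m)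
    i j :
  0 < s -> enorm (s *: (x i - o) - s *: (x j - o)) = s * enorm (x i - x j).
Proof. by move=> s0; rewrite similarityB enormZ gtr0_norm. Qed.

Lemma pot_similarity (I : finType) (B : {set I}) (x : I -> 'rV[R]_m)
    (u : I -> R) (s : R) (o : 'rV[R]_m) i : 0 < s ->
  pot B (fun j => s *: (x j - o)) (fun j => s * u j) i = pot B x u i.
Proof.
move=> s0; apply: eq_bigr => j _; rewrite similarity_dist // -mulf_div divff.
  by rewrite mul1r.
by rewrite gt_eqF.
Qed.

Lemma frc_similarity (I : finType) (B : {set I}) (x : I -> 'rV[R]_m)
    (u : I -> R) (s : R) (o : 'rV[R]_m) i :
  0 < s -> {in B &, injective x} -> i \in B ->
  s * u i *: frc B (fun j => s *: (x j - o)) (fun j => s * u j) i =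
  u i *: frc B x u i.
Proof.
move=> s0 xI iB; rewrite !scaler_sumr; apply: eq_bigr => j /andP[jB ji].
have d0 : enorm (x i - x j) != 0.
  by rewrite enorm_eq0 subr_eq0; apply: contra ji => /eqP/xI ->.
rewrite similarity_dist // similarityB !scalerA; congr (_ *: _).
by field; rewrite d0 gt_eqF.
Qed.

(** Potentials and charge times force are homogeneous of degree 0 in points and charges jointly, so
    a shrinking cluster can be magnified to unit size. *)
Lemma balanced_similarity (I : finType) (B : {set I}) (phi K : R)
    (x : nat -> I -> 'rV[R]_m) (u : nat -> I -> R) (s : nat -> R)
    (o : nat -> 'rV[R]_m) :
  (forall t, 0 < s t) -> balanced B phi x u K ->
  balanced B phi (fun t i => s t *: (x t i - o t)) (fun t i => s t * u t i) K.
Proof.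
move=> s0 [xI uK potB frcB]; split.
- move=> t i j iB jB /eqP; rewrite -subr_eq0 similarityB scaler_eq0 gt_eqF //=.
  by rewrite subr_eq0 => /eqP/xI ->.
- move=> t i j iB jB ij; rewrite similarity_dist // normrM gtr0_norm //.
  by rewrite mulrCA ler_pM2l // uK.
- by move=> i iB; under eq_cvg do rewrite pot_similarity //; exact: potB.
- move=> i iB k; under eq_cvg do rewrite frc_similarity //.
  exact: frcB.
Qed.

(** * The induction step: the limit of a normalized configuration *)

Section Step.
Context {I : finType}.
Variables (p0 : nat) (B : {set I}) (phi K : R).
Variables (x : nat -> I -> 'rV[R]_m) (u : nat -> I -> R) (b0 : I).
Hypothesis m_gt0 : (0 < m)%N.
Hypothesis rigid_le : forall q, (2 <= q <= p0)%N -> rigid R m q.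
Hypothesis cardB : (2 <= #|B| <= p0)%N.
(** Excluding a nonzero [phi] by the Kelvin transform costs one additional point, which must not
    exceed the bound [p0]. *)
Hypothesis phiB : phi = 0 \/ (#|B| < p0)%N.
Hypothesis Bbal : balanced B phi x u K.
Hypothesis b0B : b0 \in B.
Hypothesis x_b0 : forall t, x t b0 = 0.
Hypothesis x_size : forall t, \sum_(i in B) enorm (x t i) = 1.
Hypothesis IH : forall (C : {set I}) (psi : R), (#|C| < #|B|)%N ->
  (2 <= #|C|)%N -> balanced C psi x u K -> psi = 0 /\ negligible_charges C x u.

Let X i : 'rV[R]_m := \row_k lim (x t i 0 k @[t --> F]).
Let U i : R := lim (u t i @[t --> F]).
Let cluster i : {set I} := [set j in B | X j == X i].
(* The potential created at the cluster of [i] by the other limit points; the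
   charge of a nontrivial cluster vanishes in the limit ([U0]). *)
Let ext i : R := \sum_(j in B | X j != X i) U j / enorm (X i - X j).
Let S : {set I} := [set i in B | #|cluster i| <= 1]%N.

Let xI t : {in B &, injective (x t)}. Proof. by case: Bbal. Qed.

Let x_le1 t i : i \in B -> enorm (x t i) <= 1.
Proof.
move=> iB; rewrite -(x_size t) (bigD1 i) //= lerDl sumr_ge0 // => j _.
exact: enorm_ge0.
Qed.

Let other i : i \in B -> exists2 j, j \in B & j != i.
Proof.
move=> iB; have : (0 < #|B :\ i|)%N.
  by have := cardsD1 i B; rewrite iB; case/andP: cardB; lia.
by case/card_gt0P => j; rewrite !inE => /andP[ji jB]; exists j.
Qed.

Let xX i k : i \in B -> x t i 0 k @[t --> F] --> X i 0 k.
Proof.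
move=> iB; rewrite mxE; apply: (@ultra_bounded_cvg _ _ _ _ 1) => t.
exact: le_trans (enorm_coord _ _) (x_le1 _ iB).
Qed.

Let uU i : i \in B -> u t i @[t --> F] --> U i.
Proof.
move=> iB; apply: (@ultra_bounded_cvg _ _ _ _ `|K|) => t.
have [_ uK _ _] := Bbal.
(* The point [b0] sits at the origin, within distance 1 of all others; for [b0] itself any other
   point serves. *)
have [j jB [ji xij]] :
    exists2 j, j \in B & j != i /\ enorm (x t j - x t i) <= 1.
  have [eb|ib] := eqVneq i b0.
    have [j jB ji] := other iB; exists j => //; split=> //.
    by rewrite eb x_b0 subr0 x_le1.
  by exists b0 => //; rewrite eq_sym enormB x_b0 subr0 x_le1.
apply: le_trans (uK t _ _ jB iB ji) _.
apply: le_trans (ler_wpM2r (enorm_ge0 _) (ler_norm K)) _.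
by rewrite ler_piMr.
Qed.

(** If all limits coincided they would be 0, the limit of [b0], but the total size stays 1 in the
    limit. *)
Let sep i : i \in B -> exists2 j, j \in B & X j != X i.
Proof.
move=> iB; apply/exists_inP; apply: contraT => /exists_inPn Xi.
have Xb0 : X b0 = 0.
  apply/rowP => k; rewrite [RHS]mxE; apply: lim_const_eq (xX b0B) _ => t.
  by rewrite x_b0 mxE.
have XE j : j \in B -> X j = 0.
  move=> jB; rewrite -Xb0; have /eqP -> := negPn (Xi _ jB).
  exact/esym/eqP/negPn/Xi.
have : \sum_(i in B) enorm (x t i) @[t --> F] --> \sum_(i in B) enorm (X i).
  by apply: cvg_sumr => j jB; apply: cvg_enorm => k; exact: xX.
move=> /lim_const_eq /(_ x_size); rewrite big1 => [|j jB].
  by move/eqP; rewrite eq_sym oner_eq0.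
by apply/eqP; rewrite enorm_eq0 XE.
Qed.

Let mem_cluster i : i \in B -> i \in cluster i.
Proof. by move=> iB; rewrite inE iB eqxx. Qed.

Let cluster_lt i : i \in B -> (#|cluster i| < #|B|)%N.
Proof.
move=> iB; have [j jB ji] := sep iB; apply: proper_card; apply/properP; split.
  by apply/fintype.subsetP => l; rewrite inE => /andP[].
by exists j; rewrite // inE jB.
Qed.

(** The charge is at most [K] times the distance to another point of the cluster, and that distance
    tends to 0. *)
Let U0 i : i \in B -> (1 < #|cluster i|)%N -> U i = 0.
Proof.
move=> iB; rewrite (cardsD1 i) mem_cluster // ltnS => /card_gt0P[j].
rewrite !inE => /andP[ji /andP[jB /eqP Xji]].
have [_ uK _ _] := Bbal.
have : K * enorm (x t j - x t i) @[t --> F] --> K * enorm (X j - X i).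
  by apply: cvgMr; exact: (cvg_dist (B := B)).
rewrite Xji subrr (_ : enorm 0 = 0) ?mulr0; last first.
  by apply/eqP; rewrite enorm_eq0.
move=> Kd; apply/eqP; rewrite -normr_le0.
apply: (ler_cvg_to (cvg_norm (uU iB)) Kd).
by apply: filterE => t; exact: uK.
Qed.

Let cvg_ext i i' : i \in B -> i' \in cluster i ->
  \sum_(j in B | X j != X i) u t j / enorm (x t i' - x t j) @[t --> F]
  --> ext i.
Proof.
move=> iB; rewrite inE => /andP[i'B /eqP Xi'].
apply: cvg_sumr => j /andP[jB ji]; rewrite -Xi'.
by apply: (cvg_pot_term (B := B)) => //; rewrite Xi' eq_sym.
Qed.

Let cvg_ext_frc i i' k : i \in B -> i' \in cluster i ->
  (u t i' *: \sum_(j in B | X j != X i)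
     (u t j / enorm (x t i' - x t j) ^+ 3) *: (x t i' - x t j)) 0 k
  @[t --> F] -->
  (U i' *: \sum_(j in B | X j != X i)
     (U j / enorm (X i' - X j) ^+ 3) *: (X i' - X j)) 0 k.
Proof.
move=> iB; rewrite inE => /andP[i'B /eqP Xi'].
rewrite mxE summxE; under eq_cvg do rewrite mxE summxE.
apply: cvgM; first exact: uU.
apply: cvg_sumr => j /andP[jB ji].
by apply: (cvg_frc_term (B := B)) => //; rewrite Xi' eq_sym.
Qed.

Let cluster_pot i i' : i \in B -> i' \in cluster i ->
  phi + ext i + pot (cluster i) (x t) (u t) i' @[t --> F] --> (0 : R).
Proof.
move=> iB i'i; have [_ _ potB _] := Bbal.
have [i'B Xi'] : i' \in B /\ X i' == X i by apply/andP; rewrite inE in i'i.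
have potE t : phi + ext i + pot (cluster i) (x t) (u t) i' =
    phi + pot B (x t) (u t) i' -
    \sum_(j in B | X j != X i) u t j / enorm (x t i' - x t j) + ext i.
  by rewrite (@pot_split _ B (fun j => X j == X i)) // -/(cluster i); ring.
suff : phi + ext i + pot (cluster i) (x t) (u t) i' @[t --> F] -->
  0 - ext i + ext i by rewrite sub0r addNr.
under eq_cvg do rewrite potE.
exact: (cvgD (cvgB (potB _ i'B) (cvg_ext iB i'i)) (cvg_cst (ext i))).
Qed.

Let cluster_frc i i' k : i \in B -> i' \in cluster i ->
  (u t i' *: frc (cluster i) (x t) (u t) i') 0 k @[t --> F] -->
  - ((U i' *: \sum_(j in B | X j != X i)
      (U j / enorm (X i' - X j) ^+ 3) *: (X i' - X j)) 0 k).
Proof.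
move=> iB i'i; have [_ _ _ frcB] := Bbal.
have [i'B Xi'] : i' \in B /\ X i' == X i by apply/andP; rewrite inE in i'i.
have frcE t : (u t i' *: frc (cluster i) (x t) (u t) i') 0 k =
    (u t i' *: frc B (x t) (u t) i') 0 k - (u t i' *: \sum_(j in B | X j != X i)
     (u t j / enorm (x t i' - x t j) ^+ 3) *: (x t i' - x t j)) 0 k.
  rewrite (@frc_split _ B (fun j => X j == X i)) // -/(cluster i).
  by rewrite scalerDr [in RHS]mxE addrK.
under eq_cvg do rewrite frcE.
have := cvgB (frcB _ i'B k) (@cvg_ext_frc _ _ k iB i'i).
by rewrite sub0r; apply.
Qed.

(** The limit charges in the cluster vanish, so the outer forces on it die out. The cluster is then
    balanced with constant [phi + ext i], and it is smaller than [B]. *)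
Let cluster_collapse i : i \in B -> (1 < #|cluster i|)%N ->
  phi + ext i = 0 /\ negligible_charges (cluster i) x u.
Proof.
move=> iB Ci; have [_ uK _ _] := Bbal.
have CB j : j \in cluster i -> j \in B by rewrite inE => /andP[].
have XC j : j \in cluster i -> X j = X i by rewrite inE => /andP[_ /eqP].
apply: IH => //; first exact: cluster_lt.
split.
- by move=> t j l /CB jB /CB lB; exact: xI.
- by move=> t j l /CB jB /CB lB; exact: uK.
- by move=> j jC; exact: cluster_pot.
- move=> j jC k; have := @cluster_frc _ _ k iB jC.
  rewrite U0 ?CB //; first by rewrite scale0r mxE oppr0.
  by rewrite /cluster XC.
Qed.

Let cluster1 i : i \in S -> cluster i = [set i]%SET.
Proof.
rewrite inE => /andP[iB Ci]; apply/esym/eqP.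
by rewrite eqEcard cards1 Ci andbT finset.sub1set mem_cluster.
Qed.

Let SB i : i \in S -> i \in B. Proof. by rewrite inE => /andP[]. Qed.

Let U_notS i : i \in B -> i \notin S -> U i = 0.
Proof. by move=> iB; rewrite inE iB -ltnNge; exact: U0. Qed.

Let X_neq i j : i \in S -> j \in B -> (X j != X i) = (j != i).
Proof.
move=> iS jB; have := cluster1 iS => /setP/(_ j).
by rewrite !inE jB => /= ->.
Qed.

Let pot_cluster1 t i : i \in S -> pot (cluster i) (x t) (u t) i = 0.
Proof.
by move=> iS; rewrite cluster1 // /pot big1 // => j; rewrite inE andbN.
Qed.

Let frc_cluster1 t i : i \in S -> frc (cluster i) (x t) (u t) i = 0.
Proof.
by move=> iS; rewrite cluster1 // /frc big1 // => j; rewrite inE andbN.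
Qed.

(** A nontrivial cluster gets this from the induction hypothesis. For an isolated point the inner
    potential is an empty sum, so the limit relation is an equality. *)
Let ext_phi i : i \in B -> phi + ext i = 0.
Proof.
move=> iB; have [iS|] := boolP (i \in S); last first.
  by rewrite inE iB -ltnNge => /(cluster_collapse iB)[].
apply/esym; apply: lim_const_eq (cluster_pot iB (mem_cluster iB)) _ => t.
by rewrite pot_cluster1 ?addr0.
Qed.

Let X_inj : {in S &, injective X}.
Proof.
move=> i j iS jS XX; apply/eqP; rewrite eq_sym -[_ == _]negbK.
by rewrite -(X_neq iS (SB jS)) XX eqxx.
Qed.

Let limit_pot i : i \in S -> phi + pot S X U i = 0.
Proof.
move=> iS; rewrite -(ext_phi (SB iS)); congr (_ + _).
rewrite /pot /ext big_mkcond [RHS]big_mkcond; apply: eq_bigr => j _ /=.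
have [jS|jNS] := boolP (j \in S); first by rewrite SB // X_neq // SB.
have [jB|] //= := boolP (j \in B).
by rewrite U_notS // mul0r if_same.
Qed.

Let limit_frc i : i \in S -> U i *: frc S X U i = 0.
Proof.
move=> iS; have iB := SB iS; apply/rowP => k; rewrite [RHS]mxE.
have frc0 t : (u t i *: frc (cluster i) (x t) (u t) i) 0 k = 0.
  by rewrite frc_cluster1 // scaler0 mxE.
have limE := lim_const_eq (@cluster_frc _ _ k iB (mem_cluster iB)) frc0.
apply: oppr_inj; rewrite oppr0 -[RHS]limE /frc.
congr (- (fun_of_matrix (_ *: _) _ _)).
rewrite big_mkcond [RHS]big_mkcond; apply: eq_bigr => j _ /=.
have [jS|jNS] := boolP (j \in S); first by rewrite SB // X_neq // SB.
have [jB|] //= := boolP (j \in B).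
by rewrite U_notS // mul0r scale0r if_same.
Qed.

(** Two or more isolated points fall under [rigid_potential]. Otherwise some [i] in [B] is such that
    no other limit point carries a charge, so [ext i] is 0. *)
Let phi0 : phi = 0.
Proof.
have leSB : (#|S| <= #|B|)%N.
  by apply/subset_leq_card/fintype.subsetP => i; exact: SB.
have [S2|] := ltnP 1 #|S|.
  case: phiB => // ltB.
  apply: (rigid_potential (S := S) (x := X) (u := U)) => //.
  by apply: rigid_le; lia.
move=> S1; have [i iB Si] : exists2 i, i \in B & S \subset [set i]%SET.
  case: (set_0Vmem S) => [->|[i iS]].
    by exists b0; rewrite // finset.sub0set.
  exists i; first exact: SB.
  have /eqP -> // : S == [set i]%SET.
  by rewrite eq_sym eqEcard cards1 S1 andbT finset.sub1set.
rewrite -(ext_phi iB) [X in phi + X]big1 ?addr0 // => j /andP[jB ji].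
rewrite U_notS ?mul0r //; apply: contra ji => jS.
by have /fintype.subsetP/(_ j jS) := Si; rewrite inE => /eqP ->.
Qed.

Let UB i : i \in B -> U i = 0.
Proof.
move=> iB; have [iS|/U_notS -> //] := boolP (i \in S).
have leSB : (#|S| <= #|B|)%N.
  by apply/subset_leq_card/fintype.subsetP => j; exact: SB.
have [S2|S1] := ltnP 1 #|S|.
  apply: (rigid_set (S := S) (x := X) (u := U)) => //.
    by apply: rigid_le; lia.
  by move=> j /limit_pot; rewrite phi0 add0r.
have SE : S = [set i]%SET.
  by apply/esym/eqP; rewrite eqEcard cards1 S1 andbT finset.sub1set.
(* Only [i] can carry a charge, so the vanishing potential at a distinct limit point [X j] is [U i]
   over a positive distance. *)
have [j jB Xji] := sep iB.
have /eqP := ext_phi jB; rewrite phi0 add0r /ext (bigD1 i) /=; last first.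
  by rewrite iB eq_sym.
rewrite big1 ?addr0 => [|l /andP[/andP[lB _] li]]; last first.
  by rewrite U_notS ?mul0r // SE inE.
by rewrite mulf_eq0 invr_eq0 enorm_eq0 subr_eq0 (negPf Xji) orbF => /eqP.
Qed.

(** Pairs in one cluster are settled by [cluster_collapse]; for the others the distance has a
    nonzero limit while the charge tends to 0. *)
Lemma collapse_step : phi = 0 /\ negligible_charges B x u.
Proof.
split=> [|i j iB jB ij]; first exact: phi0.
have [XX|Xij] := eqVneq (X i) (X j).
  have ji : i \in cluster j by rewrite inE iB XX eqxx.
  have Cj : (1 < #|cluster j|)%N.
    rewrite (cardsD1 j) mem_cluster // ltnS; apply/card_gt0P; exists i.
    by rewrite 2!inE ij.
  by have [_] := cluster_collapse jB Cj; apply => //; exact: mem_cluster.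
have := cvg_pot_term (B := B) (fun l k => @xX l k) (fun l => @uU l) iB jB Xij.
by rewrite UB ?mul0r //; apply.
Qed.

End Step.

Lemma collapse (I : finType) (p0 : nat) (B : {set I}) (phi K : R)
    (x : nat -> I -> 'rV[R]_m) (u : nat -> I -> R) :
  (0 < m)%N -> (forall q, (2 <= q <= p0)%N -> rigid R m q) ->
  (2 <= #|B| <= p0)%N -> phi = 0 \/ (#|B| < p0)%N ->
  balanced B phi x u K -> phi = 0 /\ negligible_charges B x u.
Proof.
move=> m_gt0 rig; have [n] := ubnP #|B|.
elim: n B phi x u => // n IHn B phi x u leB cardB phiB balB.
have /card_gt0P[b0 b0B] : (0 < #|B|)%N by case/andP: cardB; lia.
have [xI _ _ _] := balB.
(* Moving [b0] to the origin and dividing by [D t] gives the normalization of the induction step. *)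
pose D t := \sum_(i in B) enorm (x t i - x t b0).
have D0 t : 0 < D t.
  rewrite lt_neqAle sumr_ge0 ?andbT => [|i _]; last exact: enorm_ge0.
  rewrite eq_sym psumr_neq0 => [|i _]; last exact: enorm_ge0.
  have : (0 < #|B :\ b0|)%N by have := cardsD1 b0 B; rewrite b0B; lia.
  case/card_gt0P => i; rewrite !inE => /andP[ib iB].
  apply/hasP; exists i; first exact: mem_index_enum.
  rewrite iB enorm_gt0 subr_eq0; apply: contra ib => /eqP/xI ->//.
have Dinv0 t : 0 < (D t)^-1 by rewrite invr_gt0.
have balB' := balanced_similarity (fun t => x t b0) Dinv0 balB.
have [|||phi0 negl] := collapse_step m_gt0 rig cardB phiB balB' b0B.
- by move=> t; rewrite subrr scaler0.
- move=> t; under eq_bigr do rewrite enormZ gtr0_norm //.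
  by rewrite -mulr_sumr mulVf // gt_eqF.
(* A smaller set leaves room for the additional point, so every [psi] is allowed. *)
- move=> C psi ltC C2 balC.
  apply: IHn balC; [lia|lia|right; lia].
split=> // i j iB jB ij; have := negl i j iB jB ij.
under eq_cvg do rewrite similarity_dist // -mulf_div divff ?mul1r ?gt_eqF //.
by [].
Qed.

End Collapse.

(** * From the system to the inequality and back *)

Section Inequality.
Context {R : realType} {m p : nat}.
Local Open Scope classical_set_scope.
Implicit Types (x : 'I_p -> 'rV[R]_m) (U : 'cV[R]_p).

Definition bahri_xu_lhs x U : R :=
  \sum_(i < p) `|potential x U i| ^+ 2
  + 2 * \big[Num.max/0]_(i < p) enorm
          (\sum_(j < p | j != i)
             (U i 0 * U j 0 / enorm (x i - x j) ^+ 3) *: (x i - x j)).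

Definition bahri_xu_rhs x U : R :=
  \sum_(i < p) \sum_(j < p | j != i) U j 0 ^+ 2 / enorm (x i - x j) ^+ 2.

Lemma force_sumE x U i :
  \sum_(j < p | j != i)
    (U i 0 * U j 0 / enorm (x i - x j) ^+ 3) *: (x i - x j) =
  U i 0 *: force_field x U i.
Proof.
by rewrite scaler_sumr; apply: eq_bigr => j _; rewrite scalerA mulrA.
Qed.

Lemma pot_setT x (u : 'I_p -> R) i :
  pot [set: 'I_p]%SET x u i = potential x (\col_j u j) i.
Proof. by apply: eq_big => [j|j _]; rewrite ?inE ?mxE. Qed.

Lemma frc_setT x (u : 'I_p -> R) i :
  frc [set: 'I_p]%SET x u i = force_field x (\col_j u j) i.
Proof. by apply: eq_big => [j|j _]; rewrite ?inE ?mxE. Qed.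

Lemma potentialZ s x U i : potential x (s *: U) i = s * potential x U i.
Proof. by rewrite mulr_sumr; apply: eq_bigr => j _; rewrite mxE mulrA. Qed.

Lemma force_fieldZ s x U i : force_field x (s *: U) i = s *: force_field x U i.
Proof.
by rewrite scaler_sumr; apply: eq_bigr => j _; rewrite mxE scalerA !mulrA.
Qed.

Lemma bahri_xu_rhsZ s x U : bahri_xu_rhs x (s *: U) = s ^+ 2 * bahri_xu_rhs x U.
Proof.
rewrite mulr_sumr; apply: eq_bigr => i _; rewrite mulr_sumr.
by apply: eq_bigr => j _; rewrite mxE exprMn mulrA.
Qed.

Lemma max_force_ge0 x U : 0 <= \big[Num.max/0]_(i < p) enorm
  (\sum_(j < p | j != i)
     (U i 0 * U j 0 / enorm (x i - x j) ^+ 3) *: (x i - x j)).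
Proof.
by elim/big_ind: _ => // [a b a0 b0|i _]; rewrite ?le_max ?a0 ?enorm_ge0.
Qed.

Lemma sum_potential_ge0 x U : 0 <= \sum_(i < p) `|potential x U i| ^+ 2.
Proof. by apply: sumr_ge0 => i _; exact: sqr_ge0. Qed.

Lemma bahri_xu_lhs_ge0 x U : 0 <= bahri_xu_lhs x U.
Proof. by rewrite addr_ge0 ?sum_potential_ge0 // mulr_ge0 // max_force_ge0. Qed.

Lemma potential_le_lhs x U i : `|potential x U i| ^+ 2 <= bahri_xu_lhs x U.
Proof.
apply: (@le_trans _ _ (\sum_(i < p) `|potential x U i| ^+ 2)); last first.
  by rewrite lerDl mulr_ge0 // max_force_ge0.
by rewrite (bigD1 i) //= lerDl sumr_ge0 // => j _; exact: sqr_ge0.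
Qed.

Lemma force_le_lhs x U i :
  enorm (U i 0 *: force_field x U i) <= bahri_xu_lhs x U.
Proof.
apply: ler_wpDl; first exact: sum_potential_ge0.
apply: le_trans (ler_peMl (max_force_ge0 x U) (ler1n R 2)).
by rewrite -force_sumE; apply: (le_bigmax _ _ i).
Qed.

Lemma charge_le_rhs x U i j : j != i ->
  U j 0 ^+ 2 / enorm (x i - x j) ^+ 2 <= bahri_xu_rhs x U.
Proof.
move=> ji; rewrite /bahri_xu_rhs (bigD1 i) //= (bigD1 j) //= -addrA lerDl.
rewrite addr_ge0 //; apply: sumr_ge0 => k _; last apply: sumr_ge0 => l _;
  by rewrite divr_ge0 ?sqr_ge0.
Qed.

Lemma rigid_of_bahri_xu : (1 < p)%N -> bahri_xu R p m -> rigid R m p.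
Proof.
move=> p1 [c c0 BX] x U xI [potU frcU]; apply/colP => j; rewrite mxE.
have := BX x U xI; rewrite -/(bahri_xu_lhs x U) -/(bahri_xu_rhs x U).
have -> : bahri_xu_lhs x U = 0.
  rewrite /bahri_xu_lhs big1 => [|i _]; last by rewrite potU normr0 expr0n.
  rewrite big1_idem ?mulr0 ?addr0 //=; first exact: maxxx.
  by move=> i _; apply/eqP; rewrite force_sumE frcU enorm_eq0.
rewrite pmulr_rle0 // => rhs0.
(* A second point makes the charge at [j] occur on the right-hand side. *)
have /card_gt0P[i ij] : (0 < #|predC1 j|)%N by rewrite cardC1 card_ord; lia.
have ji : j != i by rewrite eq_sym.
have d0 : 0 < enorm (x i - x j) by rewrite enorm_gt0 subr_eq0 inj_eq.
have := le_trans (charge_le_rhs x U ji) rhs0.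
rewrite pmulr_lle0 ?invr_gt0 ?exprn_gt0 //.
by rewrite real_exprn_even_le0 ?num_real // => /eqP.
Qed.

Lemma bahri_xu_of_rigid : (0 < m)%N -> (1 < p)%N ->
  (forall q, (2 <= q <= p)%N -> rigid R m q) -> bahri_xu R p m.
Proof.
move=> m_gt0 p1 rig; apply: contrapT => notBX.
have bad (t : nat) : exists z : ('I_p -> 'rV[R]_m) * 'cV[R]_p,
    injective z.1 /\ bahri_xu_lhs z.1 z.2 < t.+1%:R^-1 * bahri_xu_rhs z.1 z.2.
  apply: contrapT => noz; apply: notBX; exists t.+1%:R^-1.
    by rewrite invr_gt0 ltr0n.
  move=> x U xI; rewrite leNgt; apply/negP => lt.
  by apply: noz; exists (x, U).
have [z zP] := choice bad.
pose x t := (z t).1; pose N t := bahri_xu_rhs (x t) (z t).2.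
have xI t : injective (x t) by case: (zP t).
have ltN t : bahri_xu_lhs (x t) (z t).2 < t.+1%:R^-1 * N t by case: (zP t).
have N0 t : 0 < N t.
  have := le_lt_trans (bahri_xu_lhs_ge0 _ _) (ltN t).
  by rewrite pmulr_rgt0 // invr_gt0 ltr0n.
(* Both sides are quadratic in the charges; this scaling makes the right-hand side 1. *)
pose s t := (Num.sqrt (N t))^-1; pose V t := s t *: (z t).2.
have s2 t : s t ^+ 2 = (N t)^-1 by rewrite exprVn sqr_sqrtr // ltW.
have rhsV t : bahri_xu_rhs (x t) (V t) = 1.
  by rewrite bahri_xu_rhsZ s2 mulVf // gt_eqF.
(* Potentials enter the left-hand side squared, hence the square root; the forces below enter to the
   first power. *)
have potV t i : `|potential (x t) (V t) i| <= Num.sqrt (harmonic t).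
  rewrite -[leLHS]ger0_norm // -sqrtr_sqr ler_sqrt ?invr_ge0 //.
  rewrite potentialZ normrM exprMn [`|s t| ^+ 2]real_normK ?num_real // s2.
  rewrite mulrC ler_pdivrMr //.
  exact: le_trans (potential_le_lhs _ _ _) (ltW (ltN t)).
have frcV t i : enorm (V t i 0 *: force_field (x t) (V t) i) <= harmonic t.
  rewrite mxE force_fieldZ scalerA mulrAC -expr2 -scalerA enormZ s2.
  rewrite ger0_norm ?invr_ge0 ?(ltW (N0 t)) // mulrC ler_pdivrMr //.
  exact: le_trans (force_le_lhs _ _ _) (ltW (ltN t)).
have [F [FU ooF]] : exists G : set_system nat, UltraFilter G /\ \oo `<=` G.
  exact: ultraFilterLemma.
have harmF : harmonic t @[t --> F] --> (0 : R).
  by move=> A /cvg_harmonic; exact: ooF.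
have sqrtF : Num.sqrt (harmonic t) @[t --> F] --> (0 : R).
  rewrite -[X in _ --> X]sqrtr0.
  apply: (@continuous_cvg _ _ _ F _ _ Num.sqrt) => //.
  exact: sqrt_continuous.
have squeeze0 (f g : nat -> R) : (forall t, `|f t| <= g t) ->
    g t @[t --> F] --> (0 : R) -> f t @[t --> F] --> (0 : R).
  move=> fg g0; apply/norm_cvg0P; apply: squeeze_cvgr (cvg_cst 0) g0.
  by apply: filterE => t; rewrite normr_ge0 fg.
pose u t j := V t j 0.
have colu t : \col_j u t j = V t by apply/colP => j; rewrite mxE.
(* The constant 1 is the normalized right-hand side, which bounds each of its terms. *)
have bal : balanced F [set: 'I_p]%SET 0 x u 1.
  split.
  - by move=> t i j _ _; exact: xI.
  - move=> t i j _ _ ij; rewrite mul1r.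
    rewrite -(ler_pXn2r (n := 2)) ?nnegrE ?enorm_ge0 //.
    have d0 : 0 < enorm (x t i - x t j) by rewrite enorm_gt0 subr_eq0 inj_eq.
    rewrite real_normK ?num_real // -[leRHS]mul1r -ler_pdivrMr ?exprn_gt0 //.
    by rewrite -(rhsV t) charge_le_rhs // eq_sym.
  - move=> i _; under eq_cvg do rewrite add0r pot_setT colu.
    exact: squeeze0 sqrtF.
  - move=> i _ k; apply: squeeze0 harmF => t.
    by rewrite frc_setT colu; exact: le_trans (enorm_coord _ _) (frcV t i).
have [|_ negl] := collapse m_gt0 rig _ (or_introl erefl) bal.
  by rewrite cardsT card_ord p1 leqnn.
(* Negligible charges would send to 0 a right-hand side that is constantly 1. *)
suff /lim_const_eq/(_ rhsV)/eqP :
    bahri_xu_rhs (x t) (V t) @[t --> F] --> (0 : R).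
  by rewrite eq_sym oner_eq0.
rewrite -[X in _ --> X]
  (_ : \sum_(i < p) \sum_(j < p | j != i) (0 : R) ^+ 2 = 0).
  apply: cvg_sumr => i _; apply: cvg_sumr => j ji.
  under eq_cvg do rewrite -expr_div_n.
  apply: (@continuous_cvg _ _ _ F _ _ (fun y : R => y ^+ 2)).
    exact: exprn_continuous.
  by apply: negl; rewrite ?inE // eq_sym.
by rewrite big1 // => i _; rewrite big1 // => j _; rewrite expr0n.
Qed.

End Inequality.

Theorem theorem1p1 (R : realType) (m p0 : nat)
    (hm : (1 <= m)%N) (hp0 : (4 <= p0)%N) :
  (forall p : nat, (4 <= p <= p0)%N -> bahri_xu R p m)
  <->
  (forall p : nat, (4 <= p <= p0)%N ->
     forall x : 'I_p -> 'rV[R]_m, injective x ->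
       ~ exists2 U : 'cV[R]_p, U != 0 & bahri_xu_system x U).
Proof.
split=> [BX p p4 x xI [U U_neq0 sysU]|noU p p4].
  have p2 : (1 < p)%N by lia.
  by move: U_neq0; rewrite (rigid_of_bahri_xu p2 (BX p p4) xI sysU) eqxx.
apply: bahri_xu_of_rigid => [//||q q2]; first by lia.
(* Clusters may have only two or three points, so these sizes, outside the hypothesis, are treated
   directly. *)
have [q4|] := leqP 4 q; last first.
  by case: q q2 => [|[|[|[|q]]]] // _ _; [exact: rigid2|exact: rigid3].
move=> x U xI sysU; apply/eqP; apply: contraT => U_neq0.
by case: (noU q _ x xI); [lia|exists U].
Qed.
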